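(* Let $d\ge 4$ be an integer. For every triple $\mathscr{L}=(L_1,L_2,L_3)$ of pairwise distinct elements of $\mathbb{P}S_1$, the cardinality of $\Pi(\mathscr{L})\cap\overline{\Sigma}$ is $\binom{d-1}{2}$.
   Context: $S=\mathbb{C}[x,y]$, $S_i$ is the space of forms of degree $i$, and $\mathbb{P}S_i$ is its projectivization. $\mathcal{C}\subseteq\mathbb{P}S_d$ is the rational normal curve, the image of $\mathbb{P}S_1\to\mathbb{P}S_d$, $L\mapsto L^d$; $\Sigma\subseteq\mathbb{P}S_d$ is the union of all lines spanned by two different points of $\mathcal{C}$, and $\overline{\Sigma}$ is its Zariski closure (the second secant variety of $\mathcal{C}$). $\Pi(\mathscr{L})$ is the set of $F\in\mathbb{P}S_d$ that are multiples of $L_1L_2L_3$. *)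

(* Defs.v *)
From HB Require Import structures.
From mathcomp Require Import all_boot all_order all_algebra.
From mathcomp Require Import classical_sets cardinality reals complex mpoly.

Set Implicit Arguments.
Unset Strict Implicit.
Unset Printing Implicit Defensive.

Import GRing.Theory.
Local Open Scope ring_scope.
Local Open Scope classical_set_scope.

Section ProjectiveSpace.
Variables (K : fieldType) (V : vectType K).

Definition proj := {U : {vspace V} | \dim U == 1%N}.

Lemma vline_dim1 (v : V) : v != 0 -> \dim <[v]> == 1%N.
Proof. by move=> v0; rewrite dim_vline v0. Qed.

Definition proj_pt (v : V) (v0 : v != 0) : proj :=
  exist (fun U : {vspace V} => \dim U == 1%N) <[v]>%VS (vline_dim1 v0).

(* A nonzero vector on the line P; everything below that uses it is invariant
   under rescaling. *)
Definition rep (P : proj) : V := vpick (val P).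

Lemma rep_neq0 (P : proj) : rep P != 0.
Proof. by rewrite vpick0 -dimv_eq0 (eqP (valP P)). Qed.

Definition proj_line (P Q : proj) : set proj :=
  [set A | (val A <= val P + val Q)%VS].

End ProjectiveSpace.

Section BinaryForms.
Variable K : fieldType.

Definition form (d : nat) := dhomog 2 K d.

Notation PS d := (proj (form d)).

Lemma form_pow_homog (d : nat) (l : form 1) :
  (l : {mpoly K[2]}) ^+ d \is d.-homog.
Proof. by rewrite -{2}[d]mul1n; apply/dhomogMn/dhomog_is_dhomog. Qed.

Definition form_pow (d : nat) (l : form 1) : form d :=
  DHomog (form_pow_homog d l).

Lemma form_pow_neq0 (d : nat) (l : form 1) : l != 0 -> form_pow d l != 0.
Proof.
move=> l0; have lp0 : (l : {mpoly K[2]}) != 0 by rewrite -(inj_eq val_inj) in l0.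
by rewrite -(inj_eq val_inj); apply: (expf_neq0 d lp0).
Qed.

Definition veronese (d : nat) (L : PS 1) : PS d :=
  proj_pt (form_pow_neq0 d (rep_neq0 L)).

Lemma veroneseE (d : nat) (l : form 1) (l0 : l != 0) :
  veronese d (proj_pt l0) = proj_pt (form_pow_neq0 d l0).
Proof.
apply/val_inj => /=; set r := rep _.
have /vlineP[c rE] : r \in <[l]>%VS by apply: memv_pick.
have r0 : r != 0 by apply: rep_neq0.
have c0 : c != 0 by apply: contraNneq r0 => c0; rewrite rE c0 scale0r.
have -> : form_pow d r = c ^+ d *: form_pow d l.
  by apply/val_inj; rewrite /= rE /= exprZn.
apply/eqP; rewrite eqEsubv -!memvE memvZ ?memv_line //=.
by apply/vlineP; exists (c ^- d); rewrite scalerA mulVf ?scale1r ?expf_neq0.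
Qed.

Definition rational_normal_curve (d : nat) : set (PS d) := range (@veronese d).

Definition secant_lines (d : nat) : set (PS d) :=
  [set F | exists P Q : PS d,
     [/\ rational_normal_curve P, rational_normal_curve Q, P <> Q
       & proj_line P Q F]].

(* The homogeneous coordinates on the space of forms of degree d are the
   coefficients: coordinate i is the coefficient of x^(d-i) y^i. *)
Definition form_coord (d : nat) (F : form d) (i : 'I_d.+1) : K :=
  (F : {mpoly K[2]})@_[multinom [tuple (d - i)%N; (i : nat)]].

Definition zero_locus (d : nat) (I : set {mpoly K[d.+1]}) : set (PS d) :=
  [set F : PS d | forall G, I G -> G.@[form_coord (rep F)] = 0].

Definition zariski_closed (d : nat) (Z : set (PS d)) : Prop :=
  exists I : set {mpoly K[d.+1]},
    (forall G, I G -> exists e : nat, G \is e.-homog) /\ Z = zero_locus I.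

Definition zariski_closure (d : nat) (A : set (PS d)) : set (PS d) :=
  smallest (@zariski_closed d) A.

Definition multiples3 (d : nat) (L1 L2 L3 : PS 1) : set (PS d) :=
  [set F : PS d | exists G : {mpoly K[2]},
     (rep F : {mpoly K[2]}) =
       G * ((rep L1 : {mpoly K[2]}) * (rep L2 : {mpoly K[2]})
              * (rep L3 : {mpoly K[2]}))].

End BinaryForms.

Notation PS K d := (proj (form K d)).
Arguments secant_lines K d : clear implicits.
Arguments rational_normal_curve K d : clear implicits.
Arguments multiples3 {K} d L1 L2 L3.

(* Main.v *)
(* The 3 x 3 minors of the catalecticant (Hankel) matrix vanish on the closure
   of the secant lines, and a form F annihilated by a quadratic apolar form is
   either a M^d + b N^d with M, N independent or M^(d-1) N; the latter cannot
   have three distinct roots.  If a M^d + b N^d vanishes at the roots of L1, L2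
   and L3, the values of M/N there are in ratio 1 : u : v with 1, u, v distinct
   d-th roots of unity.  Conversely a pair (u, v) determines M/N up to a scalar,
   as a homography of the projective line, hence F.  Exchanging M and N is the
   only ambiguity; it replaces (u, v) by (1/u, 1/v), so writing u = z^i, v = z^j
   with z primitive, each F comes from exactly one pair 0 < i < j < d. *)

Require Import Defs.
From HB Require Import structures.
From mathcomp Require Import all_boot all_order all_algebra.
From mathcomp Require Import cyclic separable cyclotomic ring.
From mathcomp Require Import classical_sets cardinality reals complex mpoly.

Set Implicit Arguments.
Unset Strict Implicit.
Unset Printing Implicit Defensive.

Import Order.TTheory GRing.Theory Num.Theory.
Local Open Scope ring_scope.
Local Open Scope classical_set_scope.
Local Open Scope card_scope.

(** * Recurrences of order two *)

Section Recurrences.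
Variable K : fieldType.
Implicit Types (a b : K) (u : nat -> K).

(** This is the geometric progression of ratio -a/b in homogeneous form. It also covers b = 0, where
    all terms but the last vanish and the last one is free. *)
Lemma linear_recurrence1 a b u n :
  (a != 0) || (b != 0) ->
  (forall i, (i < n)%N -> a * u i + b * u i.+1 = 0) ->
  exists l, forall i, (i <= n)%N -> u i = l * (b ^+ (n - i) * (- a) ^+ i).
Proof.
have [-> | b0 _] := eqVneq b 0.
  rewrite orbF => a0 rec; exists (u n / (- a) ^+ n) => i.
  have a0' : (- a) ^+ n != 0 by rewrite expf_neq0 ?oppr_eq0.
  rewrite leq_eqVlt => /predU1P[-> | ltin].
    by rewrite subnn expr0 mul1r divfK.
  rewrite expr0n -[_ == _]negbK -lt0n subn_gt0 ltin mul0r mulr0.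
  have /eqP := rec i ltin.
  by rewrite mul0r addr0 mulf_eq0 (negPf a0) => /eqP.
move=> rec; exists (u 0 / b ^+ n); elim=> [_ | i IHi ltin].
  by rewrite subn0 expr0 mulr1 divfK ?expf_neq0.
apply: (mulfI b0); have /eqP := rec i ltin.
rewrite addrC addr_eq0 => /eqP ->; rewrite IHi 1?ltnW //.
by rewrite -(subnSK ltin) !exprS; ring.
Qed.

(* With E the shift operator, the recurrence is (a + b E) (c + e E) u = 0. *)
Lemma linear_recurrence2 a b c e u n :
  a * e - b * c != 0 ->
  (forall i, (i < n)%N ->
     a * c * u i + (a * e + b * c) * u i.+1 + b * e * u i.+2 = 0) ->
  exists l m, forall i, (i <= n.+1)%N ->
    u i = l * (e ^+ (n.+1 - i) * (- c) ^+ i) + m * (b ^+ (n.+1 - i) * (- a) ^+ i).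
Proof.
move=> D0 rec.
have ab0 : (a != 0) || (b != 0).
  rewrite -negb_and; apply: contraNN D0 => /andP[/eqP-> /eqP->].
  by rewrite !mul0r subrr.
have ce0 : (c != 0) || (e != 0).
  rewrite -negb_and; apply: contraNN D0 => /andP[/eqP-> /eqP->].
  by rewrite !mulr0 subrr.
(* The factors commute, so a + b E kills (c + e E) u and c + e E kills (a + b E) u. Cramer's rule,
   with determinant a e - b c, then recovers u. *)
have [m Hm] : exists m, forall i, (i <= n)%N ->
    c * u i + e * u i.+1 = m * (b ^+ (n - i) * (- a) ^+ i).
  apply: linear_recurrence1 => // i /rec <-; ring.
have [l Hl] : exists l, forall i, (i <= n)%N ->
    a * u i + b * u i.+1 = l * (e ^+ (n - i) * (- c) ^+ i).
  apply: linear_recurrence1 => // i /rec <-; ring.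
exists (l / (a * e - b * c)), (- m / (a * e - b * c)) => i.
(* [Hm] and [Hl] stop at n, so the last term n + 1 is solved from the pair of equations at n, every
   other term from the pair at its own index. *)
rewrite leq_eqVlt ltnS => /predU1P[-> | lein].
  apply: (mulfI D0); rewrite subnn !expr0.
  have -> : (a * e - b * c) * u n.+1 =
     a * (c * u n + e * u n.+1) - c * (a * u n + b * u n.+1) by ring.
  by rewrite Hm // Hl // subnn !exprS; field.
apply: (mulfI D0); rewrite subSn // !exprS.
have -> : (a * e - b * c) * u i =
   e * (a * u i + b * u i.+1) - b * (c * u i + e * u i.+1) by ring.
by rewrite Hm // Hl //; field.
Qed.

(** The operator is (a + b E)^2, with double root r = -a/b. The second solution i r^(i-1), the
    derivative of r^i, remains correct for r = 0. For b = 0 the root is at infinity and only the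
    last two terms are free. *)
Lemma double_recurrence2 a b u n :
  (a != 0) || (b != 0) ->
  (forall i, (i < n)%N ->
     a ^+ 2 * u i + a * b *+ 2 * u i.+1 + b ^+ 2 * u i.+2 = 0) ->
  (b = 0 /\ forall i, (i < n)%N -> u i = 0) \/
  exists r l, forall i, (i <= n.+1)%N -> u i = u 0 * r ^+ i + l * r ^+ i.-1 *+ i.
Proof.
move=> ab0 rec.
have [b0 | b0] := eqVneq b 0.
  left; split=> // i /rec; rewrite b0; move: ab0; rewrite b0 eqxx orbF => a0.
  rewrite mulr0 mul0rn mul0r addr0 expr0n mul0r addr0 => /eqP.
  by rewrite mulf_eq0 expf_eq0 /= (negPf a0) => /eqP.
right; have [l Hl] : exists l, forall i, (i <= n)%N ->
    a * u i + b * u i.+1 = l * (b ^+ (n - i) * (- a) ^+ i).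
  apply: linear_recurrence1 => // i /rec <-; ring.
exists (- a / b), (l * b ^+ n / b); elim=> [_ | i IHi lein].
  by rewrite expr0 mulr1 mulr0n addr0.
apply: (mulfI b0).
have -> : b * u i.+1 = l * (b ^+ (n - i) * (- a) ^+ i) - a * u i.
  by rewrite -(Hl i lein); ring.
rewrite IHi 1?ltnW //.
have -> : b ^+ (n - i) * (- a) ^+ i = b ^+ n * (- a / b) ^+ i.
  by rewrite exprMn exprVn -{2}(subnK (lein : (i <= n)%N)) exprD; field; rewrite expf_neq0.
case: i {IHi} lein => [|i] lein /=; rewrite ?expr0 ?mulr1n ?mulr0n ?exprS.
  by field.
by rewrite !mulrS; field.
Qed.

End Recurrences.

(** This splits q0 + q1 E + q2 E^2 as (a + b E)(c + e E). If q2 = 0, a root is at infinity and the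
    second factor is the constant 1. *)
Lemma factor_quadratic (K : closedFieldType) (q0 q1 q2 : K) :
  exists a b c e, [/\ q0 = a * c, q1 = a * e + b * c & q2 = b * e].
Proof.
have [-> | q20] := eqVneq q2 0.
  by exists q0, q1, 1, 0; split; ring.
have [r] := @solve_monicpoly K 2 (fun i => if i == 0%N then - q0 / q2 else - q1 / q2) isT.
rewrite !big_ord_recl big_ord0 /= => rE.
exists (- r), 1, (q1 + q2 * r), q2; split; [|by ring..].
have -> : - r * (q1 + q2 * r) = - (r * q1) - q2 * r ^+ 2 by ring.
by rewrite rE; field.
Qed.

(** * Maximal minors and kernel vectors *)

Section MinorsKernel.
Variable K : fieldType.

(** Full column rank would provide n rows forming an invertible submatrix, against the vanishing of
    all maximal minors. *)
Lemma minors_eq0_kernel m n (A : 'M[K]_(m, n)) :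
  (forall f : 'I_n -> 'I_m, \det (rowsub f A) = 0) ->
  exists2 q : 'cV_n, q != 0 & A *m q = 0.
Proof.
move=> minors0.
have : ~~ row_full A.
  apply/negP => fA; have := fullrowsub_unit fA.
  by rewrite unitmxE minors0 unitr0.
rewrite /row_full -mxrank_tr -[_ == _]/(row_free _) -kermx_eq0 => /rowV0Pn[v /sub_kermxP vA v0].
exists v^T; first by rewrite trmx_eq0.
by apply: trmx_inj; rewrite trmx_mul !trmxK vA trmx0.
Qed.

Lemma kernel_minors_eq0 m n (A : 'M[K]_(m, n)) (q : 'cV_n) (f : 'I_n -> 'I_m) :
  q != 0 -> A *m q = 0 -> \det (rowsub f A) = 0.
Proof.
move=> q0 Aq; rewrite -det_tr; apply/eqP/det0P; exists q^T.
  by rewrite trmx_eq0.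
by rewrite -trmx_mul mul_rowsub_mx Aq; apply/matrixP => i j; rewrite !mxE.
Qed.

End MinorsKernel.

(** * Binary forms *)

Section BinaryForms.
Variable K : fieldType.
Implicit Types (a b : K) (d i : nat) (p : {mpoly K[2]}).

Local Notation Xv := ('X_(ord0 : 'I_2) : {mpoly K[2]}).
Local Notation Yv := ('X_(ord_max : 'I_2) : {mpoly K[2]}).

Definition mon2 i j : 'X_{1..2} := [multinom [tuple i; j]].

Lemma mon2E i j : 'X_[mon2 i j] = Xv ^+ i * Yv ^+ j.
Proof.
by rewrite mpolyXE_id big_ord_recl big_ord1; congr (_ * _ ^+ _).
Qed.

Lemma mdeg_mon2 i j : mdeg (mon2 i j) = (i + j)%N.
Proof. by rewrite mdegE big_ord_recl big_ord1. Qed.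

Lemma ord2_cases (k : 'I_2) : k = ord0 \/ k = ord_max.
Proof. by case: k => [[|[|k]] ltk] //; [left|right]; apply/val_inj. Qed.

Lemma mon2_surj (m : 'X_{1..2}) : m = mon2 (m ord0) (m ord_max).
Proof.
by apply/mnmP => i; rewrite !multinomE; have [->|->] := ord2_cases i.
Qed.

Lemma mcoeff_sum_mon2 d (c : nat -> K) i : (i <= d)%N ->
  (\sum_(j < d.+1) c j *: (Xv ^+ (d - j) * Yv ^+ j))@_(mon2 (d - i) i) = c i.
Proof.
move=> led; rewrite raddf_sum /= (bigD1 (Ordinal (led : (i < d.+1)%N))) //=.
rewrite mcoeffZ -mon2E mcoeffX eqxx mulr1 big1 ?addr0 // => j jNi.
rewrite mcoeffZ -mon2E mcoeffX; case: eqP => [/mnmP/(_ ord_max) ji|]; last first.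
  by rewrite mulr0.
by case/eqP: jNi; apply/val_inj.
Qed.

Lemma dhomog_sum_mon2 d p : p \is d.-homog ->
  p = \sum_(j < d.+1) p@_(mon2 (d - j) j) *: (Xv ^+ (d - j) * Yv ^+ j).
Proof.
move=> hp; apply/mpolyP => m.
have [md|md] := eqVneq (mdeg m) d; last first.
  rewrite (dhomog_nemf_coeff hp) // raddf_sum big1 //= => j _.
  rewrite mcoeffZ -mon2E mcoeffX; case: eqP => [mE|]; last by rewrite mulr0.
  by move: md; rewrite -mE mdeg_mon2 subnK ?eqxx // -ltnS.
rewrite (mon2_surj m) mdeg_mon2 in md *.
have -> : m ord0 = (d - m ord_max)%N by rewrite -md addnK.
by rewrite (mcoeff_sum_mon2 (fun j => p@_(mon2 (d - j) j))) // -md leq_addl.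
Qed.

Lemma form_inj d (F G : Defs.form K d) :
  (forall i, (i <= d)%N ->
     (F : {mpoly K[2]})@_(mon2 (d - i) i) = (G : {mpoly K[2]})@_(mon2 (d - i) i)) ->
  F = G.
Proof.
move=> FG; apply/val_inj => /=.
rewrite (dhomog_sum_mon2 (dhomog_is_dhomog F)).
rewrite (dhomog_sum_mon2 (dhomog_is_dhomog G)).
by apply: eq_bigr => j _; rewrite FG // -ltnS.
Qed.

Lemma lin_homog a b : a *: Xv + b *: Yv \is 1.-homog.
Proof. by rewrite rpredD ?rpredZ ?dhomogX /= ?mdeg1. Qed.

Definition lin a b : Defs.form K 1 := DHomog (lin_homog a b).

Lemma lin_surj (M : Defs.form K 1) : exists a b, M = lin a b.
Proof.
exists (M : {mpoly K[2]})@_(mon2 1 0), (M : {mpoly K[2]})@_(mon2 0 1); apply/val_inj.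
rewrite /= {1}(dhomog_sum_mon2 (dhomog_is_dhomog M)) big_ord_recl big_ord1.
by rewrite !expr0 !expr1 mulr1 mul1r.
Qed.

Definition pt a b : 'I_2 -> K := fun k => if k == ord0 then a else b.

Lemma meval_lin a b s t : (lin a b : {mpoly K[2]}).@[pt s t] = a * s + b * t.
Proof. by rewrite mevalD !mevalZ !mevalXU. Qed.

Lemma linE_eq0 a b : (lin a b == 0) = (a == 0) && (b == 0).
Proof.
apply/eqP/andP => [ab0|[/eqP-> /eqP->]]; last first.
  by apply/val_inj; rewrite /= !scale0r addr0.
have e s t : a * s + b * t = 0 by rewrite -meval_lin ab0 meval0.
have:= e 1 0; have:= e 0 1.
by rewrite !mulr0 !mulr1 addr0 add0r => -> ->.
Qed.

Lemma mcoeff_lin_pow d a b i : (i <= d)%N ->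
  ((lin a b : {mpoly K[2]}) ^+ d)@_(mon2 (d - i) i) = 'C(d, i)%:R * (a ^+ (d - i) * b ^+ i).
Proof.
move=> led; rewrite -(mcoeff_sum_mon2 (fun i => 'C(d, i)%:R * (a ^+ (d - i) * b ^+ i)) led).
congr (_@_ _); rewrite /= exprDn; apply: eq_bigr => j _.
by rewrite !exprZn -scalerAl -scalerAr scalerA mulr_natl -scaler_nat scalerA mulr_natl.
Qed.

Lemma meval_form d (F : Defs.form K d) s t :
  (F : {mpoly K[2]}).@[pt s t] =
    \sum_(i < d.+1) (F : {mpoly K[2]})@_(mon2 (d - i) i) * (s ^+ (d - i) * t ^+ i).
Proof.
rewrite {1}(dhomog_sum_mon2 (dhomog_is_dhomog F)) raddf_sum /=.
by apply: eq_bigr => i _; rewrite mevalZ rmorphM !rmorphXn /= !mevalXU.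
Qed.

End BinaryForms.

(** * Catalecticants *)

Section Catalecticant.
Variable K : numClosedFieldType.
Implicit Types (d i : nat).

(** Dividing by the binomial turns the coefficients of a d-th power of a linear form into the
    geometric sequence m0^(d-i) m1^i. *)
Definition scaled_coef d (F : Defs.form K d) i : K :=
  (F : {mpoly K[2]})@_(mon2 (d - i) i) / 'C(d, i)%:R.

Lemma scaled_coefE d (F : Defs.form K d) i : (i <= d)%N ->
  (F : {mpoly K[2]})@_(mon2 (d - i) i) = 'C(d, i)%:R * scaled_coef F i.
Proof. by move=> led; rewrite mulrC divfK // pnatr_eq0 -lt0n bin_gt0. Qed.

Lemma scaled_coef_inj d (F G : Defs.form K d) :
  (forall i, (i <= d)%N -> scaled_coef F i = scaled_coef G i) -> F = G.
Proof. by move=> FG; apply: form_inj => i led; rewrite !scaled_coefE // FG. Qed.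

Lemma scaled_coef_comb d (a b m0 m1 n0 n1 : K) i : (i <= d)%N ->
  scaled_coef (a *: form_pow d (lin m0 m1) + b *: form_pow d (lin n0 n1)) i =
  a * (m0 ^+ (d - i) * m1 ^+ i) + b * (n0 ^+ (d - i) * n1 ^+ i).
Proof.
move=> led; rewrite /scaled_coef [mpoly_of_dhomog _]/= mcoeffD !mcoeffZ.
rewrite !mcoeff_lin_pow //.
by field; rewrite pnatr_eq0 -lt0n bin_gt0.
Qed.

Definition catalecticant d (F : Defs.form K d) : 'M[K]_(d.-1, 3) :=
  \matrix_(i, j) scaled_coef F (i + j).

(** A kernel vector is a recurrence of order two on the scaled coefficients, that is, a quadratic
    differential operator annihilating F. *)
Lemma catalecticant_kernelP d (F : Defs.form K d) (q : 'cV_3) :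
  catalecticant F *m q = 0 <->
  forall i, (i.+1 < d)%N -> q ord0 0 * scaled_coef F i +
     q (inord 1) 0 * scaled_coef F i.+1 + q (inord 2) 0 * scaled_coef F i.+2 = 0.
Proof.
have E (i : 'I_d.-1) : (catalecticant F *m q) i 0 = q ord0 0 * scaled_coef F i +
     q (inord 1) 0 * scaled_coef F i.+1 + q (inord 2) 0 * scaled_coef F i.+2.
  rewrite !mxE !big_ord_recl big_ord0 !mxE /= addn0 addn1 addn2 addr0 addrA.
  congr (_ + _ + _); rewrite mulrC //; congr (q _ 0 * _); apply/val_inj;
  by rewrite /= inordK.
split=> [Fq i lti | Fq].
  have lti' : (i < d.-1)%N by rewrite ltn_predRL.
  by rewrite -(E (Ordinal lti')) Fq mxE.
apply/matrixP => i j; rewrite ord1 E Fq ?mxE //.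
by rewrite -ltn_predRL.
Qed.

(** The witness consists of the coefficients of (m1 - m0 E)(n1 - n0 E), each factor killing the
    geometric sequence of one of the two powers. *)
Lemma catalecticant_sum_of_powers d (a b m0 m1 n0 n1 : K) :
  lin m0 m1 != 0 -> lin n0 n1 != 0 ->
  exists2 q : 'cV_3, q != 0 &
  catalecticant (a *: form_pow d (lin m0 m1) + b *: form_pow d (lin n0 n1)) *m q = 0.
Proof.
rewrite !linE_eq0 => m_neq0 n_neq0.
pose q : 'cV[K]_3 := \col_i nth 0 [:: m1 * n1; - (m0 * n1 + m1 * n0); m0 * n0] i.
have q0 : q ord0 0 = m1 * n1 by rewrite mxE.
have q1 : q (inord 1) 0 = - (m0 * n1 + m1 * n0) by rewrite mxE inordK.
have q2 : q (inord 2) 0 = m0 * n0 by rewrite mxE inordK.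
exists q.
  apply: contraNneq m_neq0 => qE; move: q0 q1 q2; rewrite qE !mxE.
  move=> /esym/eqP + /esym/eqP + /esym/eqP.
  rewrite oppr_eq0 !mulf_eq0.
  have [->|m10] /= := eqVneq m1 0; have [->|m00] //= := eqVneq m0 0.
  - by rewrite mul0r addr0 mulf_eq0 (negPf m00) /= => _ /eqP n1E /eqP n0E;
      rewrite n1E n0E !eqxx in n_neq0.
  - by rewrite mul0r add0r mulf_eq0 (negPf m10) /= => /eqP n1E /eqP n0E;
      rewrite n1E n0E !eqxx in n_neq0.
  - by move=> /eqP n1E _ /eqP n0E; rewrite n1E n0E !eqxx in n_neq0.
apply/catalecticant_kernelP => i lti; rewrite q0 q1 q2.
rewrite !scaled_coef_comb //; [|exact: ltnW|exact/ltnW/ltnW].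
have -> : (d - i = (d - i.+2).+2)%N by rewrite !subnSK // ltnW.
have -> : (d - i.+1 = (d - i.+2).+1)%N by rewrite !subnSK // ltnW.
by rewrite !exprS; ring.
Qed.

(** Solving the recurrence given by q yields the two normal forms: distinct factors of q give two
    d-th powers, a double factor gives M^(d-1) N. The latter is stated through values, since only
    its zeros matter later. *)
Lemma catalecticant_kernel_form d (F : Defs.form K d) (q : 'cV_3) :
  (1 < d)%N -> F != 0 -> q != 0 -> catalecticant F *m q = 0 ->
  (exists m0 m1 n0 n1 a b, m0 * n1 - m1 * n0 != 0 /\
     F = a *: form_pow d (lin m0 m1) + b *: form_pow d (lin n0 n1)) \/
  (exists M N : Defs.form K 1, [/\ M != 0, N != 0 &
     forall s t, (F : {mpoly K[2]}).@[pt s t] =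
       (M : {mpoly K[2]}).@[pt s t] ^+ d.-1 * (N : {mpoly K[2]}).@[pt s t]]).
Proof.
case: d F => [|[|n]] // F _ F0 q0 /catalecticant_kernelP Fq.
have [a [b [c [e [q0E q1E q2E]]]]] :=
  factor_quadratic (q ord0 0) (q (inord 1) 0) (q (inord 2) 0).
rewrite q0E q1E q2E in Fq.
(* For independent factors, the two basic solutions are the scaled coefficients of the d-th powers
   of [lin e (- c)] and [lin b (- a)]. *)
have [D0|D0] := eqVneq (a * e - b * c) 0; last first.
  left; have [l [m lmE]] := linear_recurrence2 (n := n.+1) (u := scaled_coef F) D0 Fq.
  exists e, (- c), b, (- a), l, m; split.
    by apply: contraNneq D0 => D0; rewrite -oppr_eq0 -D0; apply/eqP; ring.
  by apply: scaled_coef_inj => i led; rewrite scaled_coef_comb // lmE.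
right.
have abce : ((a != 0) || (b != 0)) && ((c != 0) || (e != 0)).
  rewrite -!negb_and -negb_or; apply: contraNN q0 => ab0.
  apply/eqP/matrixP => i j; rewrite ord1 mxE.
  have : [/\ a * c = 0, a * e + b * c = 0 & b * e = 0].
    by case/orP: ab0 => /andP[/eqP-> /eqP->]; split; ring.
  rewrite -q0E -q1E -q2E => -[q0' q1' q2'].
  have [->|[->|->]] // : i = ord0 \/ i = inord 1 \/ i = inord 2.
  case: i => [[|[|[|i]]] lti] //; [left|right;left|right;right];
  by apply/val_inj; rewrite /= ?inordK.
case/andP: abce => ab0 ce0.
(* The two factors are nonzero and proportional, so q is k times the square of a + b E. *)
have [k k0 [cE eE]] : exists2 k, k != 0 & c = k * a /\ e = k * b.
  have [b0|b0] := eqVneq b 0.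
    rewrite b0 eqxx orbF in ab0; move/eqP: D0.
    rewrite b0 mul0r subr0 mulf_eq0 (negPf ab0) /= => /eqP eE.
    rewrite eE eqxx orbF in ce0; exists (c / a).
      by rewrite mulf_neq0 ?invr_eq0.
    by rewrite divfK // mulr0.
  have cE : c = e / b * a.
    by apply: (mulfI b0); move/eqP: D0; rewrite subr_eq0 => /eqP <-; field.
  exists (e / b); last by rewrite divfK.
  by apply: contraTneq ce0 => eb0; rewrite cE eb0 mul0r eqxx /= -[e](divfK b0) eb0 mul0r eqxx.
have rec i : (i < n.+1)%N -> a ^+ 2 * scaled_coef F i +
    a * b *+ 2 * scaled_coef F i.+1 + b ^+ 2 * scaled_coef F i.+2 = 0.
  move=> lti; apply: (mulfI k0); rewrite mulr0 -(Fq i lti) cE eE; ring.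
have [[_ u0]|[r [l ul]]] := double_recurrence2 ab0 rec.
  (* Root at infinity: only the last two coefficients survive, so y^(d-1) divides F. *)
  exists (lin 0 1).
  exists (lin (n.+2%:R * scaled_coef F n.+1) (scaled_coef F n.+2)).
  have NE s t : (F : {mpoly K[2]}).@[pt s t] = t ^+ n.+1 *
      (n.+2%:R * scaled_coef F n.+1 * s + scaled_coef F n.+2 * t).
    rewrite meval_form 2!big_ord_recr /= big1 => [|i _]; last first.
      have lti := ltn_ord i.
      by rewrite scaled_coefE ?u0 ?mulr0 ?mul0r // ltnW // ltnW.
    rewrite !scaled_coefE // binn binSn subnn subSnn !exprS expr0; ring.
  split; first by rewrite linE_eq0 oner_eq0 andbF.
    apply: contraNneq F0 => /eqP; rewrite linE_eq0 => /andP[/eqP u1 /eqP u2].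
    apply/eqP/scaled_coef_inj => i.
    rewrite /(scaled_coef 0) mcoeff0 mul0r leq_eqVlt => /predU1P[->//|].
    rewrite ltnS leq_eqVlt => /predU1P[->|]; last by rewrite ltnS; apply: u0.
    by move/eqP: u1; rewrite mulf_eq0 pnatr_eq0 => /eqP.
  by move=> s t; rewrite NE !meval_lin mul0r add0r mul1r.
(* With u0 the first scaled coefficient, summation gives F = u0 (x + r y)^d + d l y (x + r y)^(d-1);
   the second form is the cofactor of (x + r y)^(d-1). *)
exists (lin 1 r), (lin (scaled_coef F 0) (scaled_coef F 0 * r + n.+2%:R * l)).
split; first by rewrite linE_eq0 oner_eq0.
  apply: contraNneq F0 => /eqP; rewrite linE_eq0 => /andP[/eqP u0].
  rewrite u0 mul0r add0r mulf_eq0 pnatr_eq0 => /eqP l0.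
  apply/eqP/scaled_coef_inj => i led.
  by rewrite ul // u0 l0 !mul0r mul0rn addr0 /scaled_coef mcoeff0 mul0r.
move=> s t; rewrite meval_form !meval_lin mul1r.
under eq_bigr => i _ do rewrite scaled_coefE -1?ltnS // ul -1?ltnS // mulrDr mulrDl.
rewrite big_split /=.
have -> : \sum_(i < n.+3) 'C(n.+2, i)%:R * (scaled_coef F 0 * r ^+ i) *
    (s ^+ (n.+2 - i) * t ^+ i) = scaled_coef F 0 * (s + r * t) ^+ n.+2.
  rewrite exprDn mulr_sumr; apply: eq_bigr => i _.
  by rewrite exprMn -[in RHS]mulr_natl; ring.
have -> : \sum_(i < n.+3) 'C(n.+2, i)%:R * (l * r ^+ i.-1 *+ i) *
    (s ^+ (n.+2 - i) * t ^+ i) = n.+2%:R * l * t * (s + r * t) ^+ n.+1.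
  rewrite big_ord_recl mulr0n mulr0 mul0r add0r exprDn mulr_sumr.
  apply: eq_bigr => i _; rewrite lift0 /= subSS exprMn -[in RHS]mulr_natl.
  rewrite -mulr_natl; have /(congr1 (fun k => k%:R : K)) := mul_bin_diag n.+2 i.
  rewrite /= !natrM exprS => E.
  set x := s ^+ _; rewrite [RHS](_ : _ = (n.+2%:R * 'C(n.+1, i)%:R) *
    (l * t * (x * (r ^+ i * t ^+ i)))); last by ring.
  by rewrite E; ring.
by rewrite exprS; ring.
Qed.

End Catalecticant.

(** * Secant lines and their closure *)

Section ProjectivePoints.
Variables (K : fieldType) (V : vectType K).
Implicit Types P Q A : proj V.

Lemma proj_valE P : val P = <[rep P]>%VS.
Proof.
apply/eqP; rewrite eq_sym eqEdim -memvE memv_pick dim_vline rep_neq0.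
by rewrite (eqP (valP P)).
Qed.

Lemma vline_sub_eq (u v : V) : u != 0 -> (u \in <[v]>)%VS -> <[u]>%VS = <[v]>%VS.
Proof.
move=> u0 uv; apply/eqP; rewrite eqEdim -memvE uv !dim_vline u0.
by case: (v != 0).
Qed.

Lemma proj_eqP P Q c : rep P = c *: rep Q -> P = Q.
Proof.
move=> PQ; apply/val_inj; rewrite !proj_valE.
by apply: vline_sub_eq; rewrite ?rep_neq0 // PQ memvZ // memv_line.
Qed.

Lemma proj_lineP P Q A (u w : V) : val P = <[u]>%VS -> val Q = <[w]>%VS ->
  proj_line P Q A <-> exists a b, rep A = a *: u + b *: w.
Proof.
move=> Pu Qw; rewrite /proj_line /= Pu Qw proj_valE -memvE; split.
  by case/memv_addP => _ /vlineP[a ->] [_ /vlineP[b ->] ->]; exists a, b.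
by case=> a [b ->]; rewrite memv_add // memvZ // memv_line.
Qed.

End ProjectivePoints.

Section SecantVariety.
Variable K : numClosedFieldType.
Implicit Types (d : nat).

Lemma secant_linesP d (A : PS K d) :
  secant_lines K d A <->
  exists M N : Defs.form K 1, [/\ M != 0, N != 0,
    <[form_pow d M]>%VS <> <[form_pow d N]>%VS &
    exists a b, rep A = a *: form_pow d M + b *: form_pow d N].
Proof.
split.
  move=> [_ [_ [[L _ <-] [L' _ <-]]] LL'].
  move=> /(@proj_lineP _ _ (veronese d L) (veronese d L') A (form_pow d (rep L))
    (form_pow d (rep L')) erefl erefl) hA.
  exists (rep L), (rep L'); split; rewrite ?rep_neq0 // => eqL.
  by apply: LL'; apply/val_inj.
move=> [M [N [M0 N0 MN hA]]].
exists (veronese d (proj_pt M0)), (veronese d (proj_pt N0)).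
split; [by exists (proj_pt M0)|by exists (proj_pt N0)| |].
  by rewrite !veroneseE => /(congr1 val)/= MN'; apply: MN.
rewrite !veroneseE.
exact/(@proj_lineP _ _ (proj_pt (form_pow_neq0 d M0)) (proj_pt (form_pow_neq0 d N0))
  A (form_pow d M) (form_pow d N) erefl erefl).
Qed.

(** The coordinates are unscaled coefficients, hence the inverse binomials. As f i + j is at most d,
    [inord] preserves the index. *)
Definition catalecticant_minor d (f : 'I_3 -> 'I_d.-1) : {mpoly K[d.+1]} :=
  \det (\matrix_(i < 3, j < 3)
    ('C(d, f i + j)%:R^-1 *: ('X_(inord (f i + j)) : {mpoly K[d.+1]}))).

Lemma catalecticant_minor_homog d (f : 'I_3 -> 'I_d.-1) :
  catalecticant_minor f \is 3.-homog.
Proof.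
apply: rpred_sum => s _; rewrite rpredMsign.
rewrite !big_ord_recl big_ord0 mulr1 !mxE.
apply: (dhomogM (d := 1) (e := 2)); last apply: (dhomogM (d := 1) (e := 1));
by rewrite rpredZ // dhomogX /= mdeg1.
Qed.

Lemma meval_catalecticant_minor d (f : 'I_3 -> 'I_d.-1) (F : Defs.form K d) :
  (catalecticant_minor f).@[form_coord F] = \det (rowsub f (catalecticant F)).
Proof.
rewrite -det_map_mx; congr (\det _); apply/matrixP => i j; rewrite !mxE.
rewrite /= mevalZ mevalXU /form_coord /scaled_coef mulrC inordK //.
have := ltn_ord (f i); rewrite ltn_predRL -ltnS => lti.
apply: leq_trans lti; rewrite -(addn2 (f i)) ltnS leq_add2l -ltnS.
exact: ltn_ord.
Qed.

(** The common zeros of the minors form a closed set containing every secant line, hence their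
    closure. For the other direction, the points counted at the end lie on secant lines
    themselves. *)
Lemma zariski_closure_secant_lines d (A : PS K d) :
  zariski_closure (secant_lines K d) A ->
  exists2 q : 'cV_3, q != 0 & catalecticant (rep A) *m q = 0.
Proof.
pose I := range (@catalecticant_minor d).
suff /(_ A) H : zariski_closure (secant_lines K d) `<=` zero_locus I.
  move=> /H AI; apply: minors_eq0_kernel => f.
  by rewrite -meval_catalecticant_minor; apply: AI; exists f.
apply: smallest_sub.
  by exists I; split=> // _ [f _ <-]; exists 3; apply: catalecticant_minor_homog.
move=> {}A /secant_linesP[M [N [M0 N0 _ [a [b AE]]]]] _ [f _ <-].
rewrite meval_catalecticant_minor AE.
have [m0 [m1 ME]] := lin_surj M; have [n0 [n1 NE]] := lin_surj N.
rewrite ME NE in M0 N0 *.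
have [q q0 Fq] := catalecticant_sum_of_powers d a b M0 N0.
exact: kernel_minors_eq0 q0 Fq.
Qed.

End SecantVariety.

(** * Differences of d-th powers *)

(** The polynomial T^n - N^n has the distinct roots N, u N, v N, which are split off one by one
    before T is set to M. A general domain is allowed so that M and N can be linear forms. *)
Lemma pow_sub_factor (R : idomainType) n (M N u v : R) :
  N != 0 -> u != 1 -> v != 1 -> u != v -> u ^+ n = 1 -> v ^+ n = 1 ->
  exists q, M ^+ n - N ^+ n = q * ((M - N) * (M - u * N) * (M - v * N)).
Proof.
move=> N0 u1 v1 uv un vn; pose p : {poly R} := 'X^n - (N ^+ n)%:P.
have pE t : p.[t] = t ^+ n - N ^+ n by rewrite hornerD hornerN hornerXn hornerC.
have /factor_theorem[q1 q1E] : root p N by rewrite rootE pE subrr.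
have /factor_theorem[q2 q2E] : root q1 (u * N).
  have := pE (u * N); rewrite q1E exprMn un mul1r subrr hornerM hornerXsubC => /eqP.
  rewrite mulf_eq0 => /orP[//|]; rewrite -{2}[N]mul1r -mulrBl mulf_eq0.
  by rewrite (negPf N0) orbF subr_eq0 (negPf u1).
have /factor_theorem[q3 q3E] : root q2 (v * N).
  have := pE (v * N); rewrite q1E q2E exprMn vn mul1r subrr !hornerM !hornerXsubC => /eqP.
  rewrite !mulf_eq0 -orbA => /orP[//|]; rewrite -{4}[N]mul1r -!mulrBl !mulf_eq0.
  by rewrite (negPf N0) !orbF !subr_eq0 (negPf v1) orbF eq_sym (negPf uv).
exists q3.[M]; rewrite -pE q1E q2E q3E !hornerM !hornerXsubC; ring.
Qed.

Section PowerIdentity.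
Variable K : numClosedFieldType.

Lemma poly_ext (p q : {poly K}) : (forall t, p.[t] = q.[t]) -> p = q.
Proof.
move=> pq; apply/eqP; rewrite -subr_eq0; apply/negPn/negP => pq0.
pose rs := [seq i%:R : K | i <- iota 0 (size (p - q))].
have rs_root : all (root (p - q)) rs.
  by apply/allP => t _; rewrite rootE hornerD hornerN pq subrr.
have rs_uniq : uniq rs.
  by rewrite map_inj_uniq ?iota_uniq // => i j /eqP; rewrite eqr_nat => /eqP.
by have := max_poly_roots pq0 rs_root rs_uniq; rewrite size_map size_iota ltnn.
Qed.

Lemma coef_affine_pow n (a b : K) i : (i <= n)%N ->
  ((a *: 'X + b%:P) ^+ n)`_i = 'C(n, i)%:R * (a ^+ i * b ^+ (n - i)).
Proof.
move=> lein; rewrite addrC exprDn coef_sum (bigD1 (Ordinal (lein : (i < n.+1)%N))) //=.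
rewrite big1 => [|j jNi]; rewrite -polyC_exp exprZn coefMn coefCM coefZ coefXn.
  by rewrite eqxx mulr1 addr0 mulr_natl mulrC.
case: eqP => [ij|]; last by rewrite !mulr0 mul0rn.
by case/eqP: jNi; apply/val_inj.
Qed.

(** From degree 3 on, t^n - 1 is a difference of n-th powers of independent affine forms in only one
    way, up to rescaling and exchanging t and 1. *)
Lemma pow_sub_pow_unique n (c a b e f : K) : (2 < n)%N -> a * f - b * e != 0 ->
  (forall t : K, t ^+ n - 1 = c * ((a * t + b) ^+ n - (e * t + f) ^+ n)) ->
  b = 0 /\ e = 0 \/ a = 0 /\ f = 0.
Proof.
move=> n2 D0 H.
have c0 : c != 0.
  apply/eqP => c0; have /eqP := H 0.
  by rewrite c0 mul0r expr0n gtn_eqF 1?ltnW 1?ltnW // sub0r oppr_eq0 oner_eq0.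
have /polyP P : 'X^n - 1 =
    c *: ((a *: 'X + b%:P) ^+ n - (e *: 'X + f%:P) ^+ n) :> {poly K}.
  apply: poly_ext => t.
  by rewrite !hornerE H.
(* The middle coefficients of t^n - 1 vanish; the degrees 1 and 2 suffice, and both are in range
   because n > 2. *)
have E i : (0 < i < n)%N -> a ^+ i * b ^+ (n - i) = e ^+ i * f ^+ (n - i).
  case/andP=> i0 iltn; have := P i.
  rewrite coefB coefXn coef1 (ltn_eqF iltn) (gtn_eqF i0) subrr coefZ coefB.
  rewrite !coef_affine_pow 1?ltnW // -mulrBr => /esym/eqP.
  rewrite !mulf_eq0 (negPf c0) pnatr_eq0 -[_ == 0%N]negbK -lt0n bin_gt0 (ltnW iltn) /=.
  by rewrite subr_eq0 => /eqP.
have := E 1%N; have := E 2%N; rewrite n2 (ltnW n2) => /(_ isT) + /(_ isT).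
case: n n2 {H P E} => [|[|n]] // n2; rewrite !subSS !subn0 => E2 E1.
have n0 : (0 < n)%N by [].
have [a0|a0] := eqVneq a 0.
  rewrite a0 !mul0r in E1 D0; have e0 : e != 0.
    by apply: contraNneq D0 => ->; rewrite mulr0 subrr.
  move/esym/eqP: E1; rewrite mulf_eq0 !expf_eq0 (negPf e0) /= => /eqP f0.
  by right.
have [b0|b0] := eqVneq b 0.
  rewrite b0 !(mul0r, subr0) in E1 D0; left; split=> //.
  move/esym/eqP: E1; rewrite expr0n mulr0 mulf_eq0 !expf_eq0 /=.
  case/orP => [/eqP //|/eqP f0]; by rewrite f0 mulr0 eqxx in D0.
(* When all four coefficients are nonzero, dividing [E2] by [E1] gives a/b = e/f, contrary to
   independence. *)
case/eqP: D0; apply/eqP; rewrite subr_eq0; apply/eqP.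
have ab0 : a * b ^+ n.+1 != 0 by rewrite mulf_neq0 ?expf_neq0.
have ef0 : e * f ^+ n.+1 != 0 by rewrite -[e]expr1 -E1 expr1.
have f0 : f != 0 by apply: contraNneq ef0 => ->; rewrite expr0n mulr0.
have e0 : e != 0 by apply: contraNneq ef0 => ->; rewrite mul0r.
rewrite !expr1 in E1; rewrite !expr2 in E2.
have ab1 : a * b ^+ n != 0 by rewrite mulf_neq0 ?expf_neq0.
apply: (mulfI ab0).
transitivity ((a * a * b ^+ n) * (b * f)); first by rewrite exprS; ring.
by rewrite E2 E1 exprS; ring.
Qed.

Lemma prim_root_exists n : (0 < n)%N -> exists z : K, n.-primitive_root z.
Proof.
move=> n0; have [rs rsE] := closed_field_poly_normal ('X^n - 1 : {poly K}).
have lc1 : lead_coef ('X^n - 1 : {poly K}) = 1.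
  by apply/eqP; rewrite -[_ == _]/(_ \is monic) monicXnsubC.
rewrite lc1 scale1r in rsE.
have rs_uniq : uniq rs.
  rewrite -separable_prod_XsubC -rsE; apply: separable_Xn_sub_1.
  by rewrite pnatr_eq0 -lt0n.
have rs_size : size rs = n.
  have := congr1 (fun p : {poly K} => size p) rsE.
  by rewrite size_XnsubC // size_prod_XsubC => -[].
have /hasP[z _ zP] : has n.-primitive_root rs.
  apply: has_prim_root; rewrite ?rs_size //; apply/allP => z zrs.
  by rewrite /root_of_unity rsE root_prod_XsubC.
by exists z.
Qed.
End PowerIdentity.

(** * Secant forms divisible by three given linear forms *)

Section SecantPencil.
Variable K : numClosedFieldType.
Variables (d : nat) (x0 x1 y0 y1 x y : K).
Hypotheses (XY0 : x0 * y1 - x1 * y0 != 0) (x_neq0 : x != 0) (y_neq0 : y != 0).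
Implicit Types (u v s t : K).

Local Notation X := (lin x0 x1).
Local Notation Y := (lin y0 y1).
Local Notation Z := (x *: X + y *: Y).
Local Notation mp := (@mpoly_of_dhomog 2 K _).

(* The quotient of these two linear forms takes the values 1, u, v at the zeros
   of X, Y, Z respectively. *)
Definition numer_form u v : Defs.form K 1 :=
  (- (x * (1 - v) * u)) *: X + (y * (v - u)) *: Y.

Definition denom_form u v : Defs.form K 1 :=
  (- (x * (1 - v))) *: X + (y * (v - u)) *: Y.

Definition secant_form u v : Defs.form K d :=
  form_pow d (numer_form u v) - form_pow d (denom_form u v).

Definition distinct_unity_roots u v :=
  [/\ u ^+ d = 1, v ^+ d = 1, u != 1, v != 1 & u != v].

Lemma unity_root_neq0 u : (0 < d)%N -> u ^+ d = 1 -> u != 0.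
Proof.
by move=> d0; apply: contra_eqN => /eqP->; rewrite expr0n gtn_eqF // eq_sym oner_eq0.
Qed.

Lemma point_with_values s t :
  exists p, (mp X).@[p] = s /\ (mp Y).@[p] = t.
Proof.
exists (pt ((s * y1 - t * x1) / (x0 * y1 - x1 * y0))
           ((t * x0 - s * y0) / (x0 * y1 - x1 * y0))).
by rewrite !meval_lin; split; field.
Qed.

Lemma meval_comb a b p :
  (mp (a *: X + b *: Y)).@[p] = a * (mp X).@[p] + b * (mp Y).@[p].
Proof. by rewrite /= mevalD !mevalZ. Qed.

Lemma meval_comb_pow (M N : Defs.form K 1) a b p :
  (mp (a *: form_pow d M + b *: form_pow d N)).@[p] =
  a * (mp M).@[p] ^+ d + b * (mp N).@[p] ^+ d.
Proof. by rewrite /= mevalD !mevalZ !rmorphXn. Qed.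

(** Besides the coordinates in the basis X, Y, this records that determinants are multiplied by that
    of the basis. *)
Lemma lin_comb (m0 m1 : K) : exists a b, lin m0 m1 = a *: X + b *: Y /\
  forall n0 n1 a' b', lin n0 n1 = a' *: X + b' *: Y ->
    m0 * n1 - m1 * n0 = (x0 * y1 - x1 * y0) * (a * b' - a' * b).
Proof.
pose a := (m0 * y1 - m1 * y0) / (x0 * y1 - x1 * y0).
pose b := (m1 * x0 - m0 * x1) / (x0 * y1 - x1 * y0).
have m0E : m0 = a * x0 + b * y0 by rewrite /a /b; field.
have m1E : m1 = a * x1 + b * y1 by rewrite /a /b; field.
exists a, b; split.
  apply/val_inj; rewrite /= !scalerDr !scalerA addrACA -!scalerDl.
  by rewrite -m0E -m1E.
move=> n0 n1 a' b' NE.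
have nE s t : n0 * s + n1 * t = a' * (x0 * s + x1 * t) + b' * (y0 * s + y1 * t).
  by rewrite -(meval_lin n0) NE meval_comb !meval_lin.
have n0E : n0 = a' * x0 + b' * y0 by move: (nE 1 0); rewrite !(mulr0, mulr1, addr0).
have n1E : n1 = a' * x1 + b' * y1 by move: (nE 0 1); rewrite !(mulr0, mulr1, add0r).
by rewrite n0E n1E m0E m1E; ring.
Qed.

Lemma meval_secant_form u v p :
  (mp (secant_form u v)).@[p] =
  (- (x * (1 - v) * u) * (mp X).@[p] + (y * (v - u)) * (mp Y).@[p]) ^+ d -
  (- (x * (1 - v)) * (mp X).@[p] + (y * (v - u)) * (mp Y).@[p]) ^+ d.
Proof. by rewrite -!meval_comb /= mevalB !rmorphXn. Qed.

(** Such a point shows that the two forms, and also their d-th powers, are not proportional. *)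
Lemma denom_form_root u v : distinct_unity_roots u v ->
  exists p, (mp (denom_form u v)).@[p] = 0 /\ (mp (numer_form u v)).@[p] != 0.
Proof.
case=> _ _ u1 v1 uv.
have [p [pX pY]] := point_with_values (y * (v - u)) (x * (1 - v)).
exists p; rewrite /denom_form /numer_form !meval_comb pX pY; split; first by ring.
rewrite (_ : _ + _ = x * (1 - v) * y * (v - u) * (1 - u)); last by ring.
by rewrite !mulf_neq0 // subr_eq0 // eq_sym.
Qed.

Lemma numer_form_neq0 u v : distinct_unity_roots u v -> numer_form u v != 0.
Proof.
case/denom_form_root=> p [_]; apply: contraNneq => ->.
by rewrite /= meval0.
Qed.

Lemma denom_form_neq0 u v : distinct_unity_roots u v -> denom_form u v != 0.
Proof.
case=> _ _ u1 v1 uv; have [p [pX pY]] := point_with_values 1 0.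
apply: contraTneq (x_neq0) => D0; apply/negPn.
have := meval_comb (- (x * (1 - v))) (y * (v - u)) p.
rewrite -/(denom_form u v) D0 /= meval0 pX pY mulr0 addr0 mulr1 => /esym/eqP.
by rewrite oppr_eq0 mulf_eq0 subr_eq0 [1 == v]eq_sym (negPf v1) orbF.
Qed.

Lemma powers_independent u v : (0 < d)%N -> distinct_unity_roots u v ->
  <[form_pow d (numer_form u v)]>%VS <> <[form_pow d (denom_form u v)]>%VS.
Proof.
move=> d0 /denom_form_root[p [Dp Np]] E.
have /vlineP[c cE] : form_pow d (numer_form u v) \in <[form_pow d (denom_form u v)]>%VS.
  by rewrite -E memv_line.
have := congr1 (fun F => (mp F).@[p]) cE.
rewrite /= mevalZ !rmorphXn /= Dp expr0n gtn_eqF // mulr0 => /eqP.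
by rewrite expf_eq0 (negPf Np) andbF.
Qed.

Lemma secant_form_neq0 u v : (0 < d)%N -> distinct_unity_roots u v ->
  secant_form u v != 0.
Proof.
move=> d0 uv; apply/eqP => /eqP; rewrite subr_eq0 => /eqP E.
by apply: (powers_independent d0 uv); rewrite E.
Qed.

(** With N and D the numerator and denominator, N - D, N - u D and N - v D are constant multiples of
    X, Y and Z; the constant [c] in the proof is the product of the three factors. *)
Lemma secant_form_multiple u v : distinct_unity_roots u v ->
  exists q, mp (secant_form u v) = q * (mp X * mp Y * mp Z).
Proof.
move=> uv; have := denom_form_neq0 uv; have [ud vd u1 v1 uv'] := uv.
rewrite -(inj_eq val_inj) /= => D0.
have mpC_neq (s t : K) : s != t -> s%:MP != t%:MP :> {mpoly K[2]}.
  by apply: contraNneq => /(congr1 (meval (pt 0 0))); rewrite !mevalC => ->.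
have [|||||q qE] := @pow_sub_factor _ d (mp (numer_form u v)) _ u%:MP v%:MP D0.
- exact: mpC_neq.
- exact: mpC_neq.
- exact: mpC_neq.
- by rewrite -rmorphXn ud.
- by rewrite -rmorphXn vd.
pose c := x * (1 - v) * (1 - u) * (y * (v - u) * (1 - u)) * ((1 - v) * (v - u)).
exists (c%:MP * q); move: qE; rewrite /= => ->.
rewrite -!mul_mpolyC /c; ring.
Qed.

(** Inverting u and v exchanges numerator and denominator, up to the common factor -1/(u v). *)
Lemma secant_form_inv u v : (0 < d)%N -> distinct_unity_roots u v ->
  secant_form u^-1 v^-1 = - (- (u * v)^-1) ^+ d *: secant_form u v.
Proof.
move=> d0 [/(unity_root_neq0 d0) u0 /(unity_root_neq0 d0) v0 _ _ _].
have NE : numer_form u^-1 v^-1 = (- (u * v)^-1) *: denom_form u v.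
  rewrite /numer_form /denom_form scalerDr !scalerA.
  by congr (_ *: _ + _ *: _); field; rewrite u0 v0.
have DE : denom_form u^-1 v^-1 = (- (u * v)^-1) *: numer_form u v.
  rewrite /numer_form /denom_form scalerDr !scalerA.
  by congr (_ *: _ + _ *: _); field; rewrite u0 v0.
rewrite /secant_form NE DE; apply/val_inj.
by rewrite /= !exprZn ?scaleNr scalerBr opprB.
Qed.

(** Where the forms of (u, v) take the values t and 1, those of (u', v') are affine in t, so the
    uniqueness of t^d - 1 as a difference of powers applies: the pairs agree, or the two forms are
    exchanged. *)
Lemma secant_form_line_inj u v u' v' : (2 < d)%N ->
  distinct_unity_roots u v -> distinct_unity_roots u' v' ->
  <[secant_form u v]>%VS = <[secant_form u' v']>%VS ->
  u = u' /\ v = v' \/ u * u' = 1 /\ v * v' = 1.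
Proof.
move=> d2 [ud vd u1 v1 uv] [ud' vd' u1' v1' uv'] E.
have /vlineP[c cE] : secant_form u v \in <[secant_form u' v']>%VS.
  by rewrite -E memv_line.
have u10 : 1 - u != 0 by rewrite subr_eq0 eq_sym.
have v10 : 1 - v != 0 by rewrite subr_eq0 eq_sym.
have uv0 : v - u != 0 by rewrite subr_eq0 eq_sym.
have u10' : 1 - u' != 0 by rewrite subr_eq0 eq_sym.
have v10' : 1 - v' != 0 by rewrite subr_eq0 eq_sym.
have uv0' : v' - u' != 0 by rewrite subr_eq0 eq_sym.
(* [A] and [B] are the ratios of the coordinates of [denom_form u' v'] to those
   of [denom_form u v]. *)
pose A : K := (1 - v') / (1 - v); pose B := (v' - u') / (v - u).
have A0 : A != 0 by rewrite mulf_neq0 ?invr_eq0.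
have B0 : B != 0 by rewrite mulf_neq0 ?invr_eq0.
have [] // := @pow_sub_pow_unique K d (c / (1 - u) ^+ d)
  (B - A * u') (A * u' - B * u) (B - A) (A - B * u).
- rewrite (_ : _ - _ = A * B * (1 - u) * (1 - u')); last by ring.
  by rewrite !mulf_neq0 ?invr_eq0.
- move=> t.
  (* These values of X and Y solve [numer_form u v] = t and [denom_form u v] = 1. *)
  have [p [pX pY]] := point_with_values ((t - 1) / (x * (1 - v) * (1 - u)))
                                      ((t - u) / (y * (v - u) * (1 - u))).
  have := congr1 (fun F => (mp F).@[p]) cE.
  rewrite /= mevalZ !meval_secant_form pX pY.
  rewrite [X in X ^+ d - _ = _](_ : _ = t); last first.
    by field; rewrite x_neq0 y_neq0 uv0 v10 u10.
  rewrite [X in _ - X ^+ d = _](_ : _ = 1); last first.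
    by field; rewrite x_neq0 y_neq0 uv0 v10 u10.
  rewrite expr1n => ->.
  rewrite [X in c * (X ^+ d - _)](_ : _ = (1 - u)^-1 * ((B - A * u') * t + (A * u' - B * u))); last first.
    by rewrite /A /B; field; rewrite x_neq0 y_neq0 uv0 v10 u10.
  rewrite [X in c * (_ - X ^+ d)](_ : _ = (1 - u)^-1 * ((B - A) * t + (A - B * u))); last first.
    by rewrite /A /B; field; rewrite x_neq0 y_neq0 uv0 v10 u10.
  by rewrite !exprMn exprVn; ring.
(* No exchange: A u' = B u and A = B give u = u', and then A = B gives v = v'. *)
- case=> /eqP; rewrite subr_eq0 => /eqP h1 /eqP; rewrite subr_eq0 => /eqP h2.
  left; rewrite h2 in h1; have uE : u = u' by rewrite -(mulfI A0 h1).
  split=> //; apply/eqP; rewrite -subr_eq0 -(mulrI_eq0 _ (mulfI u10)).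
  move/eqP: h2; rewrite /A /B -uE eqr_div // -subr_eq0.
  by rewrite (_ : _ - _ = - ((1 - u) * (v - v'))) ?oppr_eq0 //; ring.
(* Exchange: B = A u' and A = B u give u u' = 1, then v v' = 1. *)
case=> /eqP; rewrite subr_eq0 => /eqP h1 /eqP; rewrite subr_eq0 => /eqP h2.
right; have uE : u * u' = 1.
  by apply: (mulfI A0); rewrite mulr1 [in RHS]h2 h1; ring.
split=> //; apply/eqP; rewrite -subr_eq0 -(mulrI_eq0 _ (mulfI u10)).
move/eqP: h2; rewrite /A /B mulrAC eqr_div // -subr_eq0.
rewrite (_ : (v' - u') * u = v' * u - u * u'); last by ring.
by rewrite uE (_ : _ - _ = - ((1 - u) * (v * v' - 1))) ?oppr_eq0 //; ring: uE.
Qed.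

(** Here M = a X + b Y and N = a' X + b' Y; the three equations say that al M^d + be N^d vanishes at
    the zeros of X, Y and Z. The scalars r and r' rescale M and N to the numerator and denominator
    forms. *)
Lemma unity_root_parameters (a b a' b' al be : K) : (0 < d)%N ->
  a * b' - a' * b != 0 -> (al != 0) || (be != 0) ->
  al * b ^+ d + be * b' ^+ d = 0 -> al * a ^+ d + be * a' ^+ d = 0 ->
  al * (a * y - b * x) ^+ d + be * (a' * y - b' * x) ^+ d = 0 ->
  exists u v r r' k, distinct_unity_roots u v /\
    [/\ k != 0, al = k * r ^+ d & be = - k * r' ^+ d] /\
    [/\ r * a = - (x * (1 - v) * u), r * b = y * (v - u),
        r' * a' = - (x * (1 - v)) & r' * b' = y * (v - u)].
Proof.
move=> d0 D0 albe hb ha he.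
have zero_of p p' : al * p ^+ d + be * p' ^+ d = 0 ->
    (be != 0 -> p = 0 -> p' = 0) /\ (al != 0 -> p' = 0 -> p = 0).
  move=> h; split=> [be0 p0 | al0 p0]; move/eqP: h; rewrite p0 expr0n gtn_eqF //.
    by rewrite mulr0 add0r mulf_eq0 (negPf be0) expf_eq0 d0 => /eqP.
  by rewrite mulr0 addr0 mulf_eq0 (negPf al0) expf_eq0 d0 => /eqP.
have al0 : al != 0.
  apply: contraNneq D0 => al0; move: albe; rewrite al0 eqxx /= => be0.
  have p0 p p' : al * p ^+ d + be * p' ^+ d = 0 -> p' = 0.
    move/eqP; rewrite al0 mul0r add0r mulf_eq0 (negPf be0) expf_eq0 d0.
    by move/eqP.
  by rewrite (p0 _ _ hb) (p0 _ _ ha) !(mulr0, mul0r) subrr.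
have be0 : be != 0.
  apply: contraNneq D0 => be0.
  have p0 p p' : al * p ^+ d + be * p' ^+ d = 0 -> p = 0.
    move/eqP; rewrite be0 mul0r addr0 mulf_eq0 (negPf al0) expf_eq0 d0.
    by move/eqP.
  by rewrite (p0 _ _ hb) (p0 _ _ ha) !(mulr0, mul0r) subrr.
(* As [al] and [be] are nonzero, M and N can vanish at one of the three points only together, which
   independence forbids. *)
have b0 : b != 0.
  apply: contraNneq D0 => b0; rewrite b0 (proj1 (zero_of _ _ hb) be0 b0).
  by rewrite !mulr0 subrr.
have b'0 : b' != 0 by apply: contraNneq b0 => /(proj2 (zero_of _ _ hb) al0) ->.
have a0 : a != 0.
  apply: contraNneq D0 => a0; rewrite a0 (proj1 (zero_of _ _ ha) be0 a0).
  by rewrite !mul0r subrr.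
have a'0 : a' != 0 by apply: contraNneq a0 => /(proj2 (zero_of _ _ ha) al0) ->.
have e0 : a * y - b * x != 0.
  apply: contraNneq D0 => e0; have e'0 := proj1 (zero_of _ _ he) be0 e0.
  rewrite -(mulrI_eq0 _ (mulfI y_neq0)).
  rewrite (_ : y * (a * b' - a' * b) =
    (a * y - b * x) * b' - (a' * y - b' * x) * b); last by ring.
  by rewrite e0 e'0 !mul0r subrr.
have e'0 : a' * y - b' * x != 0.
  by apply: contraNneq e0 => /(proj2 (zero_of _ _ he) al0) ->.
(* u and v are the values of M/N at the zeros of Y and Z, divided by its value b/b' at the zero of
   X. All three values have d-th power -be/al. *)
pose u := a * b' / (a' * b).
pose v := (a * y - b * x) * b' / ((a' * y - b' * x) * b).
pose r := y * (v - u) / b; pose r' := y * (v - u) / b'.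
have ratio p p' : p' != 0 -> al * p ^+ d + be * p' ^+ d = 0 ->
    (p / p') ^+ d = - be / al.
  move=> p'0 /eqP; rewrite addr_eq0 => /eqP h.
  apply: (mulfI al0); rewrite exprMn exprVn mulrA h; field.
  by rewrite al0 expf_neq0.
have ratio1 p p' : p' != 0 -> al * p ^+ d + be * p' ^+ d = 0 ->
    (p * b' / (p' * b)) ^+ d = 1.
  move=> p'0 h; rewrite (_ : _ / _ = (p / p') / (b / b')); last by field; rewrite b0 b'0 p'0.
  rewrite exprMn exprVn !ratio // divff //.
  by rewrite mulf_neq0 ?oppr_eq0 ?invr_eq0.
have uv0 : v - u != 0.
  rewrite (_ : v - u = x * (a * b' - a' * b) * b' / ((a' * y - b' * x) * (a' * b))); last first.
    by rewrite /u /v; field; rewrite e'0 a'0 b0.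
  by rewrite !mulf_neq0 ?invr_eq0 ?mulf_neq0.
have r0 : r != 0 by rewrite !mulf_neq0 ?invr_eq0.
exists u, v, r, r', (al / r ^+ d); split; first split.
- exact: ratio1.
- exact: ratio1.
- rewrite -subr_eq0 (_ : u - 1 = (a * b' - a' * b) / (a' * b)); last first.
    by rewrite /u; field; rewrite a'0 b0.
  by rewrite mulf_neq0 ?invr_eq0 ?mulf_neq0.
- rewrite -subr_eq0 (_ : v - 1 = y * (a * b' - a' * b) / ((a' * y - b' * x) * b)); last first.
    by rewrite /v; field; rewrite e'0 b0.
  by rewrite !mulf_neq0 ?invr_eq0 ?mulf_neq0.
- by rewrite eq_sym -subr_eq0.
split; split.
- by rewrite mulf_neq0 ?invr_eq0 ?expf_neq0.
- by rewrite divfK ?expf_neq0.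
- have r'E : r' = r * (b / b') by rewrite /r /r'; field; rewrite b0 b'0.
  rewrite r'E (exprMn _ r) (ratio _ _ b'0 hb); field.
  by rewrite al0 expf_neq0.
- by rewrite /r /u /v; field; rewrite e'0 a'0 b0.
- by rewrite /r; field.
- by rewrite /r' /u /v; field; rewrite e'0 a'0 b0 b'0.
- by rewrite /r'; field.
Qed.

Lemma secant_form_surj (F : Defs.form K d) (q : 'cV_3) :
  (1 < d)%N -> F != 0 -> q != 0 -> catalecticant F *m q = 0 ->
  (forall p, (mp X).@[p] = 0 -> (mp F).@[p] = 0) ->
  (forall p, (mp Y).@[p] = 0 -> (mp F).@[p] = 0) ->
  (forall p, (mp Z).@[p] = 0 -> (mp F).@[p] = 0) ->
  exists u v k, [/\ distinct_unity_roots u v, k != 0 & F = k *: secant_form u v].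
Proof.
move=> d1 F0 q0 Fq FX FY FZ; have d0 := ltnW d1.
have [p1 [p1X p1Y]] := point_with_values 0 1.
have [p2 [p2X p2Y]] := point_with_values 1 0.
have [p3 [p3X p3Y]] := point_with_values y (- x).
have {FX}Fp1 := FX _ p1X; have {FY}Fp2 := FY _ p2Y.
have {FZ}Fp3 : (mp F).@[p3] = 0 by apply: FZ; rewrite meval_comb p3X p3Y; ring.
have [|] := catalecticant_kernel_form d1 F0 q0 Fq.
  move=> [m0 [m1 [n0 [n1 [al [be [D0 FE]]]]]]].
  have [a [b [ME /(_ n0 n1)]]] := lin_comb m0 m1.
  have [a' [b' [NE _]]] := lin_comb n0 n1.
  move=> /(_ _ _ NE) DE; rewrite DE mulf_eq0 (negPf XY0) /= in D0.
  have ev p : (mp F).@[p] = al * (a * (mp X).@[p] + b * (mp Y).@[p]) ^+ d +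
      be * (a' * (mp X).@[p] + b' * (mp Y).@[p]) ^+ d.
    by rewrite FE meval_comb_pow ME NE !meval_comb.
  rewrite !ev ?p1X ?p1Y ?p2X ?p2Y ?p3X ?p3Y ?(mulr0, mulr1, addr0, add0r, mulrN)
    in Fp1 Fp2 Fp3.
  have albe : (al != 0) || (be != 0).
    rewrite -negb_and; apply: contraNN F0 => /andP[/eqP al0 /eqP be0].
    by rewrite FE al0 be0 !scale0r addr0.
  have [u [v [r [r' [k [uv [[k0 alE beE] [h1 h2 h3 h4]]]]]]]] :=
    unity_root_parameters d0 D0 albe Fp1 Fp2 Fp3.
  exists u, v, k; split=> //.
  have rM : numer_form u v = r *: lin m0 m1.
    by rewrite ME scalerDr !scalerA h1 h2.
  have rN : denom_form u v = r' *: lin n0 n1.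
    by rewrite NE scalerDr !scalerA h3 h4.
  rewrite FE alE beE /secant_form rM rN; apply/val_inj.
  by rewrite /= !exprZn scalerBr !scalerA mulNr scaleNr.
(* In the form M^(d-1) N, one of M and N would vanish at two of the three points and hence be
   zero. *)
move=> [M [N [M0 N0 FE]]].
have [m0 [m1 ME]] := lin_surj M; have [n0 [n1 NE]] := lin_surj N.
have [a [b [ME' _]]] := lin_comb m0 m1; have [a' [b' [NE' _]]] := lin_comb n0 n1.
have {}ME := etrans ME ME'; have {}NE := etrans NE NE'.
have ev p : (mp F).@[p] = (a * (mp X).@[p] + b * (mp Y).@[p]) ^+ d.-1 *
      (a' * (mp X).@[p] + b' * (mp Y).@[p]).
  have [s [t pE]] : exists s t, p =1 pt s t.
    by exists (p ord0), (p ord_max) => k; have [->|->] := ord2_cases k.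
  by rewrite (meval_eq _ pE) FE ME NE !meval_comb !(meval_eq _ pE).
rewrite !ev ?p1X ?p1Y ?p2X ?p2Y ?p3X ?p3Y ?(mulr0, mulr1, addr0, add0r, mulrN)
  in Fp1 Fp2 Fp3.
have d10 : (0 < d.-1)%N by rewrite -ltnS prednK.
move/eqP: Fp1; move/eqP: Fp2; move/eqP: Fp3.
rewrite !mulf_eq0 !expf_eq0 d10 /= !subr_eq0 => Fp3 Fp2 Fp1.
have ab0 : ~~ ((a == 0) && (b == 0)).
  by apply: contraNN M0 => /andP[/eqP a0 /eqP b0]; rewrite ME a0 b0 !scale0r addr0.
have ab0' : ~~ ((a' == 0) && (b' == 0)).
  by apply: contraNN N0 => /andP[/eqP a0 /eqP b0]; rewrite NE a0 b0 !scale0r addr0.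
move: Fp1 Fp2 Fp3 ab0 ab0'.
have [->|b0] /= := eqVneq b 0.
  rewrite andbT => _; have [->|a0] //= := eqVneq a 0.
  move/eqP=> ->; rewrite !mul0r mulf_eq0 (negPf a0) (negPf y_neq0) /= eq_sym.
  by rewrite mulf_eq0 (negPf x_neq0) orbF eqxx => ->.
move/eqP => ->; have [->|a0] /= := eqVneq a 0.
  move=> _; rewrite !mul0r eq_sym mulf_eq0 (negPf b0) (negPf x_neq0) /=.
  by rewrite mulf_eq0 (negPf y_neq0) orbF eqxx => ->.
by move/eqP => ->; rewrite eqxx.
Qed.

End SecantPencil.

(** * Counting *)

Lemma card_ord_ltn n :
  #|[pred p : 'I_n * 'I_n | (p.1 < p.2)%N]| = 'C(n, 2).
Proof.
rewrite -sum1_card -bin2_sum big_mkord.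
rewrite (eq_bigl (fun p : 'I_n * 'I_n => true && (p.1 < p.2)%N)) //.
rewrite -(pair_big_dep xpredT (fun i j : 'I_n => (i < j)%N) (fun _ _ => 1%N)) /=.
rewrite (exchange_big_dep xpredT) //=; apply: eq_bigr => j _.
rewrite -(big_ord_widen n (fun=> 1%N)) 1?ltnW //.
by rewrite sum1_card card_ord.
Qed.

Section Count.
Variable K : numClosedFieldType.
Local Notation mp := (@mpoly_of_dhomog 2 K _).

Lemma proj_neq_det (P Q : PS K 1) (a b a' b' : K) :
  rep P = lin a b -> rep Q = lin a' b' -> P <> Q -> a * b' - b * a' != 0.
Proof.
move=> PE QE PQ; apply/eqP => /eqP; rewrite subr_eq0 => /eqP D0; apply: PQ.
have := rep_neq0 Q; rewrite QE linE_eq0 negb_and => Q0.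
have [c [aE bE]] : exists c, a = c * a' /\ b = c * b'.
  have [a'0|a'0] := eqVneq a' 0.
    rewrite a'0 eqxx /= in Q0; exists (b / b'); rewrite divfK // a'0 mulr0.
    by split=> //; apply: (mulIf Q0); rewrite D0 a'0 mulr0 mul0r.
  exists (a / a'); rewrite divfK //; split=> //; apply: (mulIf a'0).
  by rewrite -D0; field.
apply: (@proj_eqP _ _ _ _ c); rewrite PE QE; apply/val_inj.
by rewrite /= scalerDr !scalerA -aE -bE.
Qed.

Lemma prim_root_pow_neq (z : K) d i j : d.-primitive_root z ->
  (i < d)%N -> (j < d)%N -> i != j -> z ^+ i != z ^+ j.
Proof. by move=> zP ltid ltjd; rewrite (eq_prim_root_expr zP) !modn_small. Qed.

(** The points are matched with pairs i < j in ['I_d.-1]. Exponents are shifted by one, so that they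
    run through 1, ..., d - 1 and avoid the root 1. *)
Lemma card_secant_multiples d (L1 L2 L3 : PS K 1) : (2 < d)%N ->
  L1 <> L2 -> L1 <> L3 -> L2 <> L3 ->
  (multiples3 d L1 L2 L3 `&` zariski_closure (secant_lines K d))
    #= `I_('C(d.-1, 2)).
Proof.
move=> d2 h12 h13 h23; have d1 := ltnW d2; have d0 := ltnW d1.
have [x0 [x1 L1E]] := lin_surj (rep L1); have [y0 [y1 L2E]] := lin_surj (rep L2).
have [z0 [z1 L3E]] := lin_surj (rep L3).
have D0 := proj_neq_det L1E L2E h12.
have [x [y [ZE _]]] := lin_comb D0 z0 z1.
have x_neq0 : x != 0.
  apply/eqP => x0E; apply: h23; apply/esym/(@proj_eqP _ _ _ _ y).
  by rewrite L3E ZE L2E x0E scale0r add0r.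
have y_neq0 : y != 0.
  apply/eqP => y0E; apply: h13; apply/esym/(@proj_eqP _ _ _ _ x).
  by rewrite L3E ZE L1E y0E scale0r addr0.
have [z zP] := prim_root_exists K d0.
pose F := secant_form d x0 x1 y0 y1 x y.
pose T := [pred p : 'I_d.-1 * 'I_d.-1 | (p.1 < p.2)%N].
pose f (p : 'I_d.-1 * 'I_d.-1) := <[F (z ^+ p.1.+1) (z ^+ p.2.+1)]>%VS.
have ltd (i : 'I_d.-1) : (i.+1 < d)%N by rewrite -ltn_predRL.
have T_roots p : T p -> distinct_unity_roots d (z ^+ p.1.+1) (z ^+ p.2.+1).
  move=> Tp; split; rewrite -?exprM 1?mulnC ?exprM ?(prim_expr_order zP) ?expr1n //.
  - by rewrite -[1](expr0 z) (prim_root_pow_neq zP).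
  - by rewrite -[1](expr0 z) (prim_root_pow_neq zP).
  - by rewrite (prim_root_pow_neq zP) // eqSS ltn_eqF.
have f_inj : {in T &, injective f}.
  move=> [i j] [i' j'] Tij Tij' /=.
  case/(secant_form_line_inj D0 x_neq0 y_neq0 d2 (T_roots _ Tij) (T_roots _ Tij')).
    rewrite /= => -[/eqP + /eqP]; rewrite !(eq_prim_root_expr zP) !modn_small //.
    by rewrite !eqSS => /eqP/val_inj-> /eqP/val_inj->.
  (* The sum is a multiple of d strictly between 0 and 2 d. Both sums below thus equal d, which i <
     j and i' < j' make impossible. *)
  have sum_d (a b : 'I_d.-1) : z ^+ a.+1 * z ^+ b.+1 = 1 -> (a.+1 + b.+1 = d)%N.
    rewrite -exprD => /eqP; rewrite -(prim_order_dvd zP) => /dvdnP[k kE].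
    have := ltd a; have := ltd b; case: k kE => [|[|k]] // kE; first by rewrite kE mul1n.
    move=> lb la; have : (a.+1 + b.+1 < d + d)%N by rewrite -addnS leq_add // ltnW.
    by rewrite kE !mulSn addnA -{2}[(d + d)%N]addn0 ltn_add2l.
  rewrite /= => -[/sum_d ii' /sum_d jj']; exfalso.
  have ij : (i < j)%N := Tij; have ij' : (i' < j')%N := Tij'.
  have : (i.+1 + i'.+1 < j.+1 + j'.+1)%N by rewrite -addSn leq_add // ltnW.
  by rewrite ii' jj' ltnn.
set S := _ `&` _.
have SE : (val @` S) = [set f (enum_val k) | k in [set: 'I_#|T|]].
  apply/seteqP; split=> [_ [A [[G AG] AS] <-] | _ [k _ <-]].
    have [q q0 Aq] := zariski_closure_secant_lines AS.
    have A0 (M : {mpoly K[2]}) : (exists N, mp (rep A) = M * N) ->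
        forall p, M.@[p] = 0 -> (mp (rep A)).@[p] = 0.
      by move=> [N ->] p Mp; rewrite rmorphM /= Mp mul0r.
    have [|||u [v [k [uvP k0 AE]]]] :=
      secant_form_surj D0 x_neq0 y_neq0 d1 (rep_neq0 A) q0 Aq.
    - apply: A0; exists (G * (mp (rep L2) * mp (rep L3))).
      by rewrite AG -L1E; ring.
    - apply: A0; exists (G * (mp (rep L1) * mp (rep L3))).
      by rewrite AG -L2E; ring.
    - apply: A0; exists (G * (mp (rep L1) * mp (rep L2))).
      by rewrite AG -ZE -L3E; ring.
    have [ud vd u1 v1 uv] := uvP.
    have AF : val A = <[F u v]>%VS.
      rewrite proj_valE; apply: vline_sub_eq; rewrite ?rep_neq0 //.
      by rewrite AE memvZ // memv_line.
    have expE w : w ^+ d = 1 -> w != 1 -> exists i : 'I_d.-1, w = z ^+ i.+1.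
      move=> wd w1; have [[[|i] lti] wE] := prim_rootP zP wd.
        by rewrite wE eqxx in w1.
      have lti' : (i < d.-1)%N by rewrite ltn_predRL.
      by exists (Ordinal lti').
    have [i uE] := expE u ud u1; have [j vE] := expE v vd v1.
    have fT p : T p -> val A = f p -> [set f (enum_val k) | k in [set: 'I_#|T|]] (val A).
      by move=> Tp ->; exists (enum_rank_in Tp p) => //; rewrite enum_rankK_in.
    case: (ltngtP i j) => ij.
    - by apply: (fT (i, j)) => //; rewrite AF uE vE.
    (* When i > j, the inverse pair spans the same line; [rev_ord] turns each shifted exponent k
       into d - k and restores the order. *)
    - apply: (fT (rev_ord i, rev_ord j)) => /=.
        by rewrite /T /= ltn_sub2l // (leq_ltn_trans ij).
      have revE (a : 'I_d.-1) : z ^+ (rev_ord a).+1 = (z ^+ a.+1)^-1.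
        have za0 : z ^+ a.+1 != 0.
          by apply: (unity_root_neq0 d0); rewrite -exprM mulnC exprM (prim_expr_order zP) expr1n.
        apply: (mulfI za0); rewrite divff // -exprD /=.
        by rewrite addnS subnKC // prednK // (prim_expr_order zP).
      rewrite AF /f /= !revE -uE -vE /F secant_form_inv //.
      apply/esym/vline_sub_eq; last by rewrite memvZ // memv_line.
      rewrite scaler_eq0 (negPf (secant_form_neq0 D0 x_neq0 y_neq0 d0 uvP)) orbF.
      rewrite oppr_eq0 expf_eq0 oppr_eq0 invr_eq0 mulf_eq0 d0 /= negb_or.
      by rewrite (unity_root_neq0 d0 ud) (unity_root_neq0 d0 vd).
    - by move: uv; rewrite uE vE ij eqxx.
  have Tk : T (enum_val k) := enum_valP k.
  have uvP := T_roots _ Tk; set u := z ^+ _ in uvP; set v := z ^+ _ in uvP.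
  have F0 : F u v != 0 by apply: secant_form_neq0.
  exists (proj_pt F0) => //; split.
    have [q qE] : exists q, mp (F u v) = q * (mp (rep L1) * mp (rep L2) * mp (rep L3)).
      by rewrite L1E L2E L3E ZE; apply: secant_form_multiple.
    have /vlineP[c cE] : rep (proj_pt F0) \in <[F u v]>%VS by apply: memv_pick.
    by exists (c%:MP * q); rewrite -mulrA -qE cE mul_mpolyC.
  (* The point lies on the secant through the d-th powers of its numerator and denominator forms. *)
  apply: sub_gen_smallest; apply/secant_linesP.
  exists (numer_form x0 x1 y0 y1 x y u v), (denom_form x0 x1 y0 y1 x y u v).
  split.
  - exact: (numer_form_neq0 D0 x_neq0 y_neq0 uvP).
  - exact: (denom_form_neq0 y D0 x_neq0 uvP).
  - exact: (powers_independent D0 x_neq0 y_neq0 d0 uvP).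
  have /vlineP[c cE] : rep (proj_pt F0) \in <[F u v]>%VS by apply: memv_pick.
  by exists c, (- c); rewrite cE scalerBr scaleNr.
have card_T : #|T| = 'C(d.-1, 2) := card_ord_ltn d.-1.
rewrite -card_T.
have S_val : S #= (val @` S) by rewrite card_eq_sym; apply: inj_card_eq => ? ? _ _; exact: val_inj.
apply: (card_eq_trans S_val); rewrite SE.
apply: card_eq_trans (inj_card_eq _) _.
  by move=> k k' _ _ /f_inj E; apply: enum_val_inj; apply: E; apply: enum_valP.
by rewrite card_eq_sym card_II.
Qed.
End Count.

Theorem proposition4p12 (R : realType) (d : nat) (hd : (4 <= d)%N)
  (L1 L2 L3 : PS (complex R) 1)
  (h12 : L1 <> L2) (h13 : L1 <> L3) (h23 : L2 <> L3) :
  (multiples3 d L1 L2 L3 `&` zariski_closure (secant_lines (complex R) d))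
    #= `I_('C(d.-1, 2)).
Proof. exact: (card_secant_multiples (ltnW hd) h12 h13 h23). Qed.
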